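(* Let $\bar h\ge0$, let the weights $a_{ij}:[0,\infty)\to[0,\infty)$ be locally $L_1$-summable and the delays $h_{ij}:[0,\infty)\to[0,\bar h]$ Lebesgue measurable. Suppose that $\sup_{t\ge0,\ i,j\in\mathcal V}\int_t^{t+D}a_{ij}(s)\,ds<\infty$ for every finite $D>0$ (this can be discarded if $\bar h=0$) and that $A(\cdot)=(a_{ij}(\cdot))$ is aperiodically quasi-strongly connected (AQSC), with sequence $(t_p)_{p\ge0}$ as in the definition of AQSC. Let $\theta\in(0,1)$ be the number (which exists under these assumptions and depends only on $A(\cdot)$ and $h_{ij}(\cdot)$) such that every solution of the undisturbed system $\dot x_i(t)=\sum_{j\ne i}a_{ij}(t)(x_j(t-h_{ij}(t))-x_i(t))$, $i\in\mathcal V$, with starting time $t_*\ge0$ and limit $\bar x=\lim_{t\to\infty}x(t)$ satisfies $$\|x(t)-\bar x\|_\infty\le\Lambda(t)-\lambda(t)\le\theta^k\bigl(\Lambda(t_* )-\lambda(t_* )\bigr)\qquad\forall k\ge0\ \ \forall t:\ t_{r+2k(n-1)}\le t\le t_{r+2(k+1)(n-1)},$$ where $r$ is an index such that $t_r\ge t_*$ and $n=|\mathcal V|$. Then, for any solution of the disturbed system $$\dot x_i(t)=\sum_{j\in\mathcal V,\ j\ne i}a_{ij}(t)\bigl(x_j(t-h_{ij}(t))-x_i(t)\bigr)+f_i(t),\qquad i\in\mathcal V,$$ with locally $L_1$-summable $f=(f_i)_{i\in\mathcal V}$, the following inequality holds: $$\limsup_{t\to\infty}\Bigl(\max_i x_i(t)-\min_i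 x_i(t)\Bigr)\le C\limsup_{p\to\infty}\int_{t_p}^{t_{p+1}}\|f(t)\|_\infty\,dt,$$ where $C=C(\theta)$ is a constant determined by $\theta$. In particular, the disturbed algorithm establishes global consensus when $$\int_{t_p}^{t_{p+1}}|f_i(t)|\,dt\xrightarrow[p\to\infty]{}0\qquad\forall i\in\mathcal V.$$
   Context: $\mathcal V$ is a finite set of agents, and $\|x\|_\infty=\max_i|x_i|$ for $x\in\mathbb R^{\mathcal V}$. Solutions: for a starting time $t_*\ge0$, the solution (right-continuous at $t_*$) is determined on $[t_*,\infty)$ by the initial condition $x(t_* )=x_*\in\mathbb R^{\mathcal V}$ and $x(t_*+s)=\varphi(s)$ for $s\in[-\bar h,0)$, where $\varphi\in L_\infty([-\bar h,0]\to\mathbb R^{\mathcal V})$. For a solution: $\lambda(t)=\inf_{t-\bar h\le s\le t}\min_i x_i(s)$, $\Lambda(t)=\sup_{t-\bar h\le s\le t}\max_i x_i(s)$. Global consensus: for every starting time $t_*\ge0$ and every initial condition, the limits $\bar x_i=\lim_{t\to\infty}x_i(t)$ exist for all $i\in\mathcal V$ and $\bar x_i=\bar x_j$ for all $i,j\in\mathcal V$. Graphs: for a nonnegative matrix $M=(m_{ij})_{i,j\in\mathcal V}$, the graph $\mathcal G[M]$ has node set $\mathcal V$ and an arc $(j,i)$ whenever $m_{ij}>0$. A directed graph is quasi-strongly connected if some node (a root) is connected to all other nodes by walks. $\mathcal G[M]$ is quasi-strongly $\varepsilon$-connected if the graph obtained by keeping only the arcs $(j,i)$ with $m_{ij}\ge\varepsilon$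 is quasi-strongly connected. AQSC: there exist $\varepsilon>0$ and an increasing sequence $t_p\ge0$, $p=0,1,\dots$, $t_p\to\infty$, such that (i) $\mathcal G\bigl[\int_{t_p}^{t_{p+1}}A(s)\,ds\bigr]$ is quasi-strongly $\varepsilon$-connected for every $p$; (ii) $\sup_{p\ge0,\ i\ne j}\int_{t_p}^{t_{p+1}}a_{ij}(s)\,ds<\infty$.
   Formalization: The final claim of global consensus is false as stated (f_i = 1/(1+t), no delay, gives x_i = ln(1+t)); proved instead: max_i x_i − min_i x_i → 0, and consensus for any solution of which at least one component converges. *)

(* Defs.v *)
From HB Require Import structures.
From mathcomp Require Import all_boot all_order all_algebra.
From mathcomp Require Import all_classical all_reals all_analysis.

Set Implicit Arguments.
Unset Strict Implicit.
Unset Printing Implicit Defensive.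

Import Order.TTheory GRing.Theory Num.Theory.
Import numFieldNormedType.Exports.
Local Open Scope classical_set_scope.
Local Open Scope ring_scope.

(* The real line with the Lebesgue (not merely Borel) sigma-algebra, which is
   the domain of completed_lebesgue_measure. *)
Notation lebesgueType R := (caratheodory_type (@wlength R idfun)^*%mu).
Notation leb := completed_lebesgue_measure.

Section Defs.
Context {R : realType} {V : finType}.
Implicit Types (hbar theta t tstar : R) (tp : R^nat) (g : R -> R).
Implicit Types (a h : V -> V -> R -> R) (f x : R -> V -> R) (v : V -> R).

Definition lebesgue_measurable (D : set R) g : Prop :=
  measurable_fun (D : set (lebesgueType R)) (g : lebesgueType R -> R).

Definition loc_summable g : Prop :=
  forall T : R, 0 <= T -> leb.-integrable `[0, T] (EFin \o g).

Definition abs_continuous (b c : R) g : Prop :=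
  forall e : R, 0 < e -> exists2 d : R, 0 < d &
    forall (n : nat) (u w : 'I_n -> R),
      (forall k, b <= u k /\ u k <= w k /\ w k <= c) ->
      trivIset setT (fun k => `]u k, w k[%classic) ->
      \sum_(k < n) (w k - u k) < d ->
      \sum_(k < n) `|g (w k) - g (u k)| < e.

(* range v is finite, so sup and inf are attained as soon as V is nonempty. *)
Definition vmax v : R := sup (range v).
Definition vmin v : R := inf (range v).
Definition norm_inf v : R := \big[Num.max/0]_i `|v i|.

(* Entry (i, j) of a matrix M gives the arc from j to i. *)
Definition graph (M : V -> V -> R) : rel V := [rel j i | 0 < M i j].

Definition quasi_strongly_connected (e : rel V) : Prop :=
  exists r : V, forall i : V, connect e r i.

Definition quasi_strongly_eps_connected (eps : R) (M : V -> V -> R) : Prop :=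
  quasi_strongly_connected [rel j i | graph M j i && (eps <= M i j)].

(* A = (a_ij) is aperiodically quasi-strongly connected with sequence tp. *)
Definition AQSC a tp : Prop :=
  exists eps : R,
  [/\ 0 < eps,
      [/\ forall p, 0 <= tp p, increasing_seq tp & tp @ \oo --> +oo],
      forall p, quasi_strongly_eps_connected eps
        (fun i j => \int[leb]_(s in `[tp p, tp p.+1]) a i j s)
    & exists K : R, forall p i j, i != j ->
        \int[leb]_(s in `[tp p, tp p.+1]) a i j s <= K].

Definition uniformly_bounded_integrals a : Prop :=
  forall D : R, 0 < D -> exists K : R, forall t i j, 0 <= t ->
    \int[leb]_(s in `[t, t + D]) a i j s <= K.

Definition rhs a h f x (t : R) (i : V) : R :=
  \sum_(j | j != i) a i j t * (x (t - h i j t) j - x t i) + f t i.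

(* Caratheodory solution of the disturbed system on [tstar, +oo) together with
   its prehistory on [tstar - hbar, tstar); the values of x elsewhere are
   irrelevant. Since the delays may evaluate the prehistory on a null set, an
   L_infty initial function is given by an everywhere bounded representative. *)
Definition solution hbar a h f tstar x : Prop :=
  [/\ forall i, lebesgue_measurable `[tstar - hbar, tstar[ (x^~ i),
      exists K : R, forall s i,
        tstar - hbar <= s -> s < tstar -> `|x s i| <= K,
      forall (T : R) i, tstar <= T -> abs_continuous tstar T (x^~ i)
    & forall i, {ae leb, forall t : R, tstar < t ->
        is_derive t 1 (x^~ i) (rhs a h f x t i)}].

Definition Lambda hbar x t : R :=
  sup [set vmax (x s) | s in `[t - hbar, t]].
Definition lambda hbar x t : R :=
  inf [set vmin (x s) | s in `[t - hbar, t]].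

(* theta is a contraction rate for all solutions of the undisturbed system. *)
Definition contraction_rate hbar a h tp theta : Prop :=
  let m := #|V|.-1 in
  forall tstar x, 0 <= tstar -> solution hbar a h (fun _ _ => 0) tstar x ->
  exists xbar : V -> R,
    (forall i, x t i @[t --> +oo] --> xbar i) /\
    forall (r k : nat) (t : R), tstar <= tp r ->
      tp (r + 2 * k * m)%N <= t -> t <= tp (r + 2 * k.+1 * m)%N ->
      norm_inf (fun i => x t i - xbar i) <= Lambda hbar x t - lambda hbar x t /\
      Lambda hbar x t - lambda hbar x t <=
        theta ^+ k * (Lambda hbar x tstar - lambda hbar x tstar).

(* A disturbance with vanishing integrals over [tp p, tp p.+1] need not let the
   individual limits exist: without delays, f t i = 1 / (1 + t) shifts every
   solution by ln (1 + t), up to a constant, and leaves all differences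
   unchanged. Such a disturbance only forces agreement, vmax - vmin --> 0, and
   consensus in the sense below as soon as some component converges. *)
Definition reaches_consensus x : Prop :=
  exists xbar : V -> R, (forall i, x t i @[t --> +oo] --> xbar i) /\
    forall i j, xbar i = xbar j.

End Defs.

(* Main.v *)
Require Import Defs.
From mathcomp Require Import all_boot all_order all_algebra.
From mathcomp Require Import all_classical all_reals all_analysis.
From mathcomp Require Import measurable_realfun.
From mathcomp Require Import lra ring.
Set Implicit Arguments.
Unset Strict Implicit.
Unset Printing Implicit Defensive.
Import Order.TTheory GRing.Theory Num.Theory.
Import numFieldNormedType.Exports.
Local Open Scope classical_set_scope.
Local Open Scope ring_scope.

(** A solution [x] of the disturbed system is compared, on one period
    [[tp r, tp (r + 4 m)]] with [m = #|V|.-1], with an undisturbed solution [y]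
    that has the same past at time [tp r].  The difference [z = x - y] is the
    forced response: it solves the disturbed system and vanishes up to [tp r].

    The response never exceeds the mass of the disturbance,
    [`|z t i| <= \int_(tp r)^t norm_inf (f s) ds]: an agent whose value is the
    largest one is only pulled down by its neighbours, so only [f] can raise the
    maximum ([forced_response_upper], a maximum principle; the lower bound is
    the same statement for [- z] and [- f]).  Since [theta] contracts the spread
    [Lambda - lambda] of [y] over a period,
      [spread x (tp (r + 2 m)) <= theta * spread x (tp r) + 8 m I]
    as soon as no interval [[tp p, tp p.+1]] carries a disturbance mass above
    [I] ([period_contraction]).  Iterating this affine contraction bounds the
    limit superior of the spread by [8 m I / (1 - theta)]
    ([disagreement_eventually]), and [I] may be taken arbitrarily close to the
    limit superior of the masses.

    The point that needs care is the existence of [y].  Solving the undisturbed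
    equation from the past of [x] directly is delicate, because a past that is
    merely Lebesgue measurable, evaluated at a Lebesgue measurable delayed time,
    may fail to be measurable.  The forced response has a zero past, hence is
    continuous on the whole line, and its delayed values are measurable.  So [z]
    is constructed first, as a fixed point of the Picard operator
    ([forced_response_exists]), and [y := x - z] solves the undisturbed equation
    by linearity ([solution_sub_forced]).  Both the convergence of the Picard
    iterates and the maximum principle are proved by advancing in time by steps
    over which the total weight has integral at most [1 / 4]
    ([interval_induction]).

    Solutions are characterized by derivatives almost everywhere for the
    completed Lebesgue measure, so the primitive of a function that is
    measurable for that measure has to be differentiated; this is reduced to the
    Borel case by replacing the function by an almost everywhere equal Borel one
    ([borel_version], [leb_FTC]). *)

(** * Lebesgue measurable functions and their primitives *)

Section Lebesgue.
Context {R : realType}.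
Implicit Types (g : R -> R) (D : set R).

Lemma leb_measurable D : measurable D -> measurable (D : set (lebesgueType R)).
Proof. exact: sub_caratheodory. Qed.

Lemma leb_itv (i : interval R) : measurable ([set` i] : set (lebesgueType R)).
Proof. by apply: leb_measurable; exact: measurable_itv. Qed.

Lemma leb_borel D : leb D = lebesgue_measure D.
Proof. by []. Qed.

Lemma leb_measurable_fun D g : measurable D -> measurable_fun D g ->
  lebesgue_measurable D g.
Proof.
move=> mD mg _ B mB; apply: leb_measurable; exact: mg.
Qed.

Lemma leb_measurable_id : measurable_fun setT (id : lebesgueType R -> R).
Proof. by move=> _ B mB; rewrite setTI; exact: leb_measurable. Qed.

Lemma leb_measurable_comp D g (F : R -> R) : continuous F ->
  lebesgue_measurable D g -> lebesgue_measurable D (F \o g).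
Proof.
move=> cF mg; apply: measurableT_comp => //.
exact: continuous_measurable_fun.
Qed.

(** The superlevel sets of [g] at the countably many rational levels are Borel up
    to null sets.  Outside a single Borel null set [N] covering all these
    defects, [g] is Borel, and it is set to [0] on [N]. *)
Lemma borel_version g : lebesgue_measurable setT g ->
  exists g' : R -> R, measurable_fun setT g' /\
  lebesgue_measure.-negligible [set x | g x != g' x].
Proof.
move=> mg.
(* [q] enumerates the rationals; the default value [0] is harmless. *)
pose q n : R := ratr (odflt 0 (unpickle n : option rat)).
have split_ (n : nat) : exists BN : set R * set R,
    [/\ measurable BN.1, measurable BN.2, lebesgue_measure BN.2 = 0%E,
    BN.1 `<=` [set x | q n < g x] &
    [set x | q n < g x] `<=` BN.1 `|` BN.2].
  have : measurable ([set x | q n < g x] : set (lebesgueType R)).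
    rewrite -[X in measurable X]setTI.
    rewrite (_ : [set x | q n < g x] = g @^-1` `]q n, +oo[); last first.
      by apply/seteqP; split => x /=; rewrite in_itv/= andbT.
    by apply: mg => //; exact: leb_measurable.
  rewrite -[X in X _](@completed_caratheodory_measurable R).
  rewrite g_sigma_completed_algebra_genE => -[B mB [N [N' [mN' N'0 NN']]]] BN.
  exists (B, N'); split => //=; rewrite -BN; first by move=> x; left.
  by move=> x [|/NN']; [left|right].
have [BN BNP] := choice split_.
pose N := \bigcup_n (BN n).2.
have mN : measurable N.
  by apply: bigcupT_measurable => n; have [] := BNP n.
pose g' x := if x \in N then 0 else g x.
exists g'; split; last first.
  exists N; split => //.
    have neglN : lebesgue_measure.-negligible N.
      apply: (@negligible_bigcup _ (measurableTypeR R)) => n.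
      by have [_ m2 n2 _ _] := BNP n; exists (BN n).2; split.
    exact: (@measure_negligible _ (measurableTypeR R) _ _ _ mN neglN).
  by move=> x /=; rewrite /g'; case: ifPn => [/set_mem//|]; rewrite eqxx.
move=> _; apply: (measurability _ (RGenOInfty.measurableE R)) => // _ [_ [y ->] <-].
rewrite setTI.
rewrite (_ : g' @^-1` _ = (\bigcup_(n in [set n | y < q n]) ((BN n).1 `\` N))
    `|` (if y < 0 then N else set0)); last first.
  apply/seteqP; split => x /=; rewrite in_itv/= andbT.
    rewrite /g'; case: ifPn => [/set_mem Nx ->|/negP xN yx]; first by right.
    left; have [r /=] := rat_in_itvoo yx; rewrite in_itv/= => /andP[yr rx].
    have rE : q (pickle r) = ratr r by rewrite /q pickleK.
    exists (pickle r); first by rewrite /= rE.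
    split; last by move/mem_set.
    have [_ _ _ _ /(_ x)] := BNP (pickle r).
    rewrite /= rE => /(_ rx)[//|B2]; exfalso; apply: xN.
    by apply/mem_set; exists (pickle r).
  rewrite /g' => -[[n /= yn [Bx Nx]]|].
    rewrite (memNset Nx); apply: (lt_trans yn).
    by have [_ _ _ /(_ x Bx)] := BNP n.
  by case: ifPn => // y0 /mem_set ->.
apply: measurableU; last by case: ifP.
apply: bigcup_measurable => n _; apply: measurableD => //.
by have [] := BNP n.
Qed.

Lemma integrable_leb_borel D g : measurable D -> measurable_fun setT g ->
  leb.-integrable D (EFin \o g) -> lebesgue_measure.-integrable D (EFin \o g).
Proof.
move=> mD mg ig.
have mg' : measurable_fun setT (EFin \o g) by exact/measurable_EFinP.
have H := @integrable_pushforward _ _ (lebesgueType R) (measurableTypeR R) R id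
  leb_measurable_id leb D (EFin \o g) mg' ig mD.
exact: H.
Qed.

Lemma Rintegral_leb_borel D g : measurable D -> measurable_fun setT g ->
  leb.-integrable D (EFin \o g) ->
  \int[leb]_(t in D) g t = \int[lebesgue_measure]_(t in D) g t.
Proof.
move=> mD mg ig; rewrite /Rintegral; congr fine.
have mg' : measurable_fun setT (EFin \o g) by exact/measurable_EFinP.
have H := @integral_pushforward _ _ (lebesgueType R) (measurableTypeR R) R id
  leb_measurable_id leb D (EFin \o g) mg' ig mD.
exact: (esym H).
Qed.

End Lebesgue.

Section Primitive.
Context {R : realType}.
Implicit Types (g : R -> R) (D : set R) (P : R -> Prop) (t u w T : R).

Lemma ae_leb P : {ae lebesgue_measure, forall t, P t} -> {ae leb, forall t, P t}.
Proof.
by move=> [A [mA A0 sA]]; exists A; split => //; exact: leb_measurable.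
Qed.

(** The Lebesgue differentiation theorem for Borel functions, transferred to
    [g] through its Borel version, which has the same primitive. *)
Lemma leb_FTC g t0 : (forall t, leb.-integrable `]t0, t] (EFin \o g)) ->
  {ae leb, forall t, t0 < t ->
     is_derive t 1 (fun x => \int[leb]_(s in `]t0, x]) g s) (g t)}.
Proof.
move=> ig.
have mg : lebesgue_measurable setT (g \_ `]t0, +oo[).
  apply/(measurable_restrictT _ _).1; first exact: leb_itv.
  rewrite itv_bndy_bigcup_BRight.
  apply/measurable_fun_bigcup => n; first exact: leb_itv.
  apply/measurable_EFinP; exact: measurable_int (ig _).
have [g1 [mg1 [N [mN N0 sN]]]] := borel_version mg.
pose g2 := g1 \_ `]t0, +oo[.
have mg2 : measurable_fun setT g2.
  by apply/(measurable_restrictT _ _).1 => //; exact: measurable_funTS.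
have g2E x : ~ N x -> t0 < x -> g2 x = g x.
  move=> Nx tx; rewrite /g2 patchE mem_set/= ?in_itv/= ?tx//.
  have : (g \_ `]t0, +oo[) x = g1 x.
    by apply: contra_notP Nx => /eqP ne; apply: sN; exact/negP/negP.
  by rewrite patchE mem_set/= ?in_itv/= ?tx.
have aeE t : ae_eq leb `]t0, t]%classic (EFin \o g) (EFin \o g2).
  exists N; split => //; first exact: leb_measurable.
  move=> x /= /not_implyP[]; rewrite in_itv/= => /andP[tx _] ne.
  by apply: contra_notP ne => Nx; rewrite g2E.
have lm2 t : measurable_fun (`]t0, t]%classic : set (lebesgueType R)) (EFin \o g2).
  apply/measurable_EFinP; apply: (leb_measurable_fun (D := `]t0, t]%classic)) => //.
  exact: measurable_funTS.
have ig2 t : leb.-integrable `]t0, t] (EFin \o g2).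
  have /integrableP[mgt goo] := ig t; apply/integrableP; split => //.
  apply: le_lt_trans goo; rewrite le_eqVlt; apply/orP; left; apply/eqP/esym.
  apply: ae_eq_integral.
  - exact: leb_itv.
  - exact: measurableT_comp.
  - exact: measurableT_comp.
  - exact: ae_eq_abse.
have -> : (fun x => \int[leb]_(s in `]t0, x]) g s) =
          (fun x => \int[lebesgue_measure]_(s in `]t0, x]) g2 s).
  apply/funext => t; rewrite -Rintegral_leb_borel//; congr fine.
  apply: ae_eq_integral.
  - exact: leb_itv.
  - exact: measurable_int (ig t).
  - exact: lm2.
  - exact: aeE.
have bg2 t : lebesgue_measure.-integrable `]t0, t] (EFin \o g2).
  exact: integrable_leb_borel.
have lg2 : locally_integrable [set: R] g2.
  split => //; first exact: openT.
  move=> K _ cK.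
  have [M [_ KM]] := compact_bounded cK.
  pose T := `|M| + 1.
  have KT x : K x -> x <= T.
    move=> Kx; apply: le_trans (ler_norm x) _; apply: KM Kx.
    by rewrite (le_lt_trans (ler_norm M))// ltrDl.
  have mK : measurable K by exact: compact_measurable.
  apply: (@le_lt_trans _ _
    (\int[lebesgue_measure]_(x in K `&` `]t0, +oo[) `|(g2 x)%:E|)%E).
    rewrite integral_mkcondr le_eqVlt; apply/orP; left; apply/eqP.
    apply: eq_integral => x _; rewrite patchE; case: ifPn => //= xt.
    by rewrite /g2 patchE (negbTE xt) normr0.
  have /integrableP[_] := bg2 T; apply: le_lt_trans.
  apply: ge0_subset_integral => //=; first exact: measurableI.
    by apply/measurable_EFinP/measurableT_comp => //; exact: measurable_funTS.
  by move=> x [Kx] /=; rewrite !in_itv/= andbT => ->; exact: KT.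
have := FTC1 bg2 lg2.
move=> /ae_leb.
have N' : {ae leb, forall t, ~ N t}.
  exists N; split => //; first exact: leb_measurable.
  by move=> x /= /contrapT.
apply: filterS2 N'; first exact: (ae_filter_ringOfSetsType leb).
move=> t Nt + tt; rewrite /= lte_fin => /(_ tt)[dF FE].
by rewrite -(g2E _ Nt tt) -FE derive1E; exact: DeriveDef.
Qed.

Lemma Rintegral_itv_split g t0 u w : t0 <= u -> u <= w ->
  leb.-integrable `]t0, w] (EFin \o g) ->
  \int[leb]_(s in `]t0, w]) g s =
  \int[leb]_(s in `]t0, u]) g s + \int[leb]_(s in `]u, w]) g s.
Proof.
move=> tu uw ig.
have E : `]t0, w]%classic = `]t0, u] `|` `]u, w].
  by rewrite -itv_bndbnd_setU// bnd_simp.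
rewrite E Rintegral_setU//; try exact: leb_itv; first by rewrite -E.
apply/disj_setPLR => x /=; rewrite !in_itv/= => /andP[_ xu].
by apply/negP; rewrite negb_and -leNgt xu.
Qed.

Lemma integral_fine g u w : leb.-integrable `]u, w] (EFin \o g) ->
  (\int[leb]_(s in `]u, w]) (g s)%:E = (\int[leb]_(s in `]u, w]) g s)%:E)%E.
Proof.
move=> ig; rewrite /Rintegral fineK//; apply: integrable_fin_num => //.
exact: leb_itv.
Qed.

Lemma leb_itv_oc u w : u <= w -> leb (`]u, w]%classic) = (w - u)%:E.
Proof.
move=> uw; rewrite leb_borel lebesgue_measure_itv/= lte_fin.
case: ltP => // wu; congr EFin; apply/eqP.
by rewrite eq_sym subr_eq0 eq_le uw wu.
Qed.

(** Disjoint open intervals remain disjoint once their right ends are added. *)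
Lemma itv_oo_meet u w u' w' :
  `]u, w] `&` `]u', w'] !=set0 -> `]u, w[ `&` `]u', w'[ !=set0.
Proof.
move=> [x [/=]]; rewrite !in_itv/= => /andP[ux xw] /andP[ux' xw'].
by have [uu'|uu'] := leP u u'; [exists ((u' + x) / 2)|exists ((u + x) / 2)];
  split => /=; rewrite in_itv/=; lra.
Qed.

(** Absolute continuity of the integral with respect to the measure, applied to a
    finite union of disjoint intervals. *)
Lemma abs_continuous_Rintegral_itv g t0 T :
  leb.-integrable `]t0, T] (EFin \o g) ->
  forall e, 0 < e -> exists2 d, 0 < d & forall (n : nat) (u w : 'I_n -> R),
    (forall k, t0 <= u k /\ u k <= w k /\ w k <= T) ->
    trivIset setT (fun k => `]u k, w k[%classic) ->
    \sum_(k < n) (w k - u k) < d ->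
    \sum_(k < n) \int[leb]_(s in `]u k, w k]) `|g s| < e.
Proof.
move=> ig e e0.
have mI u w : measurable (`]u, w]%classic : set (lebesgueType R)).
  exact: leb_itv.
have igT : leb.-integrable setT (EFin \o (g \_ `]t0, T])).
  rewrite -restrict_EFin; apply/integrable_restrict => //=.
  by rewrite setTI.
have [d [d0 dP]] := integral_normr_continuous igT e0.
exists d => // n u w uw tuw sd.
have sub k : `]u k, w k] `<=` `]t0, T].
  have [tu [_ wT]] := uw k.
  by apply: subset_itv; rewrite bnd_simp.
have igk k : leb.-integrable `]u k, w k] (EFin \o (fun s => `|g s|)).
  apply: integrable_norm; exact: (integrableS (mI _ _) (mI _ _) (sub k) ig).
have triv : trivIset setT (fun k => `]u k, w k]%classic).
  move=> j k _ _ jk; apply: (tuw j k I I); exact: itv_oo_meet.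
pose A := \big[setU/set0]_(k < n) `]u k, w k]%classic.
have mA : measurable (A : set (lebesgueType R)) by exact: bigsetU_measurable.
have lA : (leb A < d%:E)%E.
  rewrite measure_semi_additive_ord//.
  rewrite (eq_bigr (fun k => (w k - u k)%:E)).
    by rewrite sumEFin lte_fin.
  by move=> k _; have [_ [uwk _]] := uw k; exact: leb_itv_oc.
apply: le_lt_trans (dP _ mA lA).
have igA : leb.-integrable A (EFin \o (fun s => `|(g \_ `]t0, T]) s|)).
  by apply: integrable_norm; exact: (integrableS _ mA _ igT).
rewrite -lee_fin -sumEFin /Rintegral (fineK (integrable_fin_num mA igA)).
rewrite integral_bigsetU_EFin//; last 3 first.
- exact: index_enum_uniq.
- exact: sub_trivIset triv.
- exact: measurable_int igA.
rewrite le_eqVlt; apply/orP; left; apply/eqP; apply: eq_bigr => k _.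
rewrite -integral_fine//; apply: eq_integral => s /set_mem/sub sT.
by rewrite patchE mem_set.
Qed.

End Primitive.

(** * Functions summable on an interval *)

Section Summable.
Context {R : realType}.
Implicit Types (g k : R -> R) (u w c K T : R).

(** Half-open intervals make integrals over adjacent intervals add up without
    any discussion of null sets. *)
Definition summable_on u w g := leb.-integrable `]u, w] (EFin \o g).

Lemma summable_onS u w u' w' g : u <= u' -> w' <= w ->
  summable_on u w g -> summable_on u' w' g.
Proof.
move=> uu' ww'; apply: integrableS; try exact: leb_itv.
by apply: subset_itv; rewrite bnd_simp.
Qed.

Lemma summable_onD u w g k :
  summable_on u w g -> summable_on u w k -> summable_on u w (fun s => g s + k s).
Proof. by move=> ig ik; apply: integrableD ig ik; exact: leb_itv. Qed.

Lemma summable_onB u w g k :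
  summable_on u w g -> summable_on u w k -> summable_on u w (fun s => g s - k s).
Proof. by move=> ig ik; apply: integrableB ig ik; exact: leb_itv. Qed.

Lemma summable_on_sum (I : Type) (r : seq I) (P : pred I) u w (g : I -> R -> R) :
  (forall i, P i -> summable_on u w (g i)) ->
  summable_on u w (fun s => \sum_(i <- r | P i) g i s).
Proof.
move=> ig; rewrite /summable_on.
have -> : EFin \o (fun s => \sum_(i <- r | P i) g i s) =
          (fun s => \sum_(i <- r | P i) (g i s)%:E)%E.
  by apply/funext => s /=; rewrite sumEFin.
by apply: integrable_sum => //; exact: leb_itv.
Qed.

Lemma summable_on_le u w g k : lebesgue_measurable `]u, w] g ->
  (forall s, u < s -> s <= w -> `|g s| <= k s) ->
  summable_on u w k -> summable_on u w g.
Proof.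
move=> mg gk; apply: le_integrable; first exact: leb_itv.
  exact/measurable_EFinP.
move=> s /=; rewrite in_itv/= => /andP[us sw].
by rewrite lee_fin; apply: le_trans (gk _ us sw) _; exact: ler_norm.
Qed.

Lemma summable_on_measurable u w g :
  summable_on u w g -> lebesgue_measurable `]u, w] g.
Proof. by move=> ig; apply/measurable_EFinP; exact: measurable_int ig. Qed.

Lemma summable_on_norm u w g : summable_on u w g -> summable_on u w (fun s => `|g s|).
Proof. exact: integrable_norm. Qed.

Lemma summable_onZ c u w g : summable_on u w g -> summable_on u w (fun s => c * g s).
Proof.
by move=> ig; apply: (integrableZl _ c ig); exact: leb_itv.
Qed.

Lemma summable_onM K u w g k : summable_on u w g -> lebesgue_measurable `]u, w] k ->
  (forall s, u < s -> s <= w -> `|k s| <= K) ->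
  summable_on u w (fun s => g s * k s).
Proof.
move=> ig mk kK; apply: (summable_on_le (k := fun s => K * `|g s|)).
- by apply: measurable_funM => //; exact: summable_on_measurable.
- by move=> s us sw; rewrite normrM mulrC ler_wpM2r// kK.
- by apply: summable_onZ; exact: summable_on_norm.
Qed.

Lemma loc_summable_on u w g : 0 <= u -> loc_summable g -> summable_on u w g.
Proof.
move=> u0 lg; have [w0|w0] := leP 0 w.
  apply: (integrableS _ _ _ (lg w w0)); try exact: leb_itv.
  by move=> s /=; rewrite !in_itv/= => /andP[us ->]; rewrite ltW ?(le_lt_trans u0).
rewrite /summable_on set_itv_ge; last first.
  by rewrite bnd_simp -leNgt ltW// (lt_le_trans w0).
exact: integrable_set0.
Qed.

Lemma le_Rintegral_itv u w g k : summable_on u w g -> summable_on u w k ->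
  (forall s, u < s -> s <= w -> g s <= k s) ->
  \int[leb]_(s in `]u, w]) g s <= \int[leb]_(s in `]u, w]) k s.
Proof.
move=> ig ik gk; apply: le_Rintegral => //; first exact: leb_itv.
by move=> s /=; rewrite in_itv/= => /andP[]; exact: gk.
Qed.

Lemma Rintegral_itv_sum (I : Type) (r : seq I) u w (g : I -> R -> R) :
  (forall i, summable_on u w (g i)) ->
  \int[leb]_(s in `]u, w]) (\sum_(i <- r) g i s) =
  \sum_(i <- r) \int[leb]_(s in `]u, w]) g i s.
Proof.
move=> ig; elim: r => [|i r IH].
  rewrite big_nil -[RHS](mul0r
    (fine (leb (`]u, w]%classic : set (lebesgueType R))))).
  rewrite -Rintegral_cst; last exact: leb_itv.
  by apply: eq_Rintegral => s _; rewrite big_nil.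
rewrite big_cons -IH -RintegralD.
- by apply: eq_Rintegral => s _; rewrite big_cons.
- exact: leb_itv.
- exact: ig.
- by apply: summable_on_sum => j _.
Qed.

Lemma Rintegral_itv_oc_le_cc u w g : leb.-integrable `[u, w] (EFin \o g) ->
  (forall s, 0 <= g s) ->
  \int[leb]_(s in `]u, w]) g s <= \int[leb]_(s in `[u, w]) g s.
Proof.
move=> ig g0; have sub : `]u, w] `<=` `[u, w] by exact: subset_itv_oc_cc.
have ig' : summable_on u w g.
  exact: (integrableS (leb_itv _) (leb_itv _) sub ig).
rewrite /Rintegral fine_le//.
- by apply: integrable_fin_num; [exact: leb_itv|exact: ig'].
- by apply: integrable_fin_num; [exact: leb_itv|exact: ig].
apply: ge0_subset_integral; try exact: leb_itv.
- exact: measurable_int ig.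
- by move=> s _; rewrite lee_fin.
- exact: sub.
Qed.

Lemma Rintegral_itv_small t0 T g : t0 <= T -> summable_on t0 T g ->
  forall e, 0 < e -> exists2 d, 0 < d & forall u w, t0 <= u -> u <= w ->
    w <= T -> w - u < d -> \int[leb]_(s in `]u, w]) `|g s| < e.
Proof.
move=> tT ig e e0.
have [d d0 dP] := abs_continuous_Rintegral_itv ig e0.
exists d => // u w tu uw wT wud.
have := dP 1%N (fun=> u) (fun=> w); rewrite !big_ord1; apply => //.
by move=> i j _ _ _; rewrite !ord1.
Qed.

Lemma abs_continuous_primitive t0 T g : summable_on t0 T g ->
  abs_continuous t0 T (fun t => \int[leb]_(s in `]t0, t]) g s).
Proof.
move=> ig e e0.
have [d d0 dP] := abs_continuous_Rintegral_itv ig e0.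
exists d => // n u w uw tuw sd; apply: le_lt_trans (dP n u w uw tuw sd).
apply: ler_sum => k _; have [tu [uwk wT]] := uw k.
rewrite (@Rintegral_itv_split _ g t0 (u k))//; last exact: summable_onS ig.
rewrite addrAC subrr add0r.
apply: le_normr_Rintegral; first exact: leb_itv.
exact: summable_onS ig.
Qed.

Lemma Rintegral_itv_ge u w g : w <= u -> \int[leb]_(s in `]u, w]) g s = 0.
Proof.
by move=> wu; rewrite set_itv_ge ?Rintegral_set0// bnd_simp -leNgt.
Qed.

(** Extending [x] to the left of [t0] by its value at [t0] turns one-sided
    regularity on [[t0, +oo[] into continuity on the whole line. *)
Lemma abs_continuous_continuous_max t0 x :
  (forall T, t0 <= T -> abs_continuous t0 T x) ->
  continuous (fun t : R => x (Num.max t0 t)).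
Proof.
move=> acx t; apply/cvgrPdist_lt => e e0.
set p := Num.max t0 t; pose T := p + 1.
have tp : t0 <= p by rewrite le_max lexx.
have tT : t0 <= T by rewrite ler_wpDr.
have [d d0 dP] := acx T tT e e0.
have dP1 u w : t0 <= u -> u <= w -> w <= T -> w - u < d -> `|x w - x u| < e.
  move=> tu uw wT uwd.
  have := dP 1%N (fun=> u) (fun=> w); rewrite !big_ord1; apply => //.
  by move=> i j _ _ _; rewrite !ord1.
have near_ : \forall y \near t, `|t - y| < Num.min d 1.
  by apply/nbhs_ballP; exists (Num.min d 1); rewrite //= lt_min d0/=.
near=> y.
have : `|t - y| < Num.min d 1 by near: y.
rewrite lt_min => /andP[yd y1].
set q := Num.max t0 y.
have tq : t0 <= q by rewrite le_max lexx.
have pq : `|p - q| <= `|t - y|.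
  rewrite /p /q; case: (leP t0 t) => ?; case: (leP t0 y) => ? //.
  - by rewrite !ger0_norm; lra.
  - by rewrite !ler0_norm; lra.
  - by rewrite subrr normr0.
have {}yd := le_lt_trans pq yd; have {}y1 := le_lt_trans pq y1.
move: yd y1; rewrite !ltr_norml => /andP[? ?] /andP[? ?].
rewrite -ltr_norml.
have [pq'|/ltW qp'] := leP p q; last by apply: dP1 => //; rewrite /T; lra.
by rewrite distrC; apply: dP1 => //; rewrite /T; lra.
Unshelve. all: by end_near. Qed.

Lemma continuous_primitive t0 g : (forall T, summable_on t0 T g) ->
  continuous (fun t => \int[leb]_(s in `]t0, t]) g s).
Proof.
move=> ig.
have -> : (fun t => \int[leb]_(s in `]t0, t]) g s) =
          (fun t => \int[leb]_(s in `]t0, Num.max t0 t]) g s).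
  by apply/funext => t; case: leP => // /ltW tt0; rewrite !Rintegral_itv_ge.
apply: (abs_continuous_continuous_max
  (x := fun t => \int[leb]_(s in `]t0, t]) g s)) => T _.
exact: abs_continuous_primitive.
Qed.

End Summable.

(** * The Picard operator for responses from rest *)

Section Forced.
Context {R : realType} {V : finType}.
Implicit Types (t s u w T K : R) (f z : R -> V -> R) (v : V -> R).

Lemma norm_inf_ge v i : `|v i| <= norm_inf v.
Proof. exact: (le_bigmax _ (fun i => `|v i|)). Qed.

Lemma norm_inf_le v K : 0 <= K -> (forall i, `|v i| <= K) -> norm_inf v <= K.
Proof. by move=> K0 vK; apply/bigmax_leP; split. Qed.

Lemma norm_inf_ge0 v : 0 <= norm_inf v.
Proof. exact: bigmax_ge_id. Qed.

Lemma measurable_norm_inf (D : set R) f :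
  (forall i, lebesgue_measurable D (f^~ i)) ->
  lebesgue_measurable D (fun s => norm_inf (f s)).
Proof.
move=> mf; rewrite /norm_inf; elim: (index_enum V) => [|i r IH].
  have -> : (fun s => \big[Num.max/0]_(j <- [::]) `|f s j|) = cst 0.
    by apply/funext => s; rewrite big_nil.
  exact: measurable_cst.
have -> : (fun s => \big[Num.max/0]_(j <- i :: r) `|f s j|) =
    (fun s => `|f s i|) \max (fun s => \big[Num.max/0]_(j <- r) `|f s j|).
  by apply/funext => s; rewrite big_cons.
apply: measurable_maxr; last exact: IH.
exact: (leb_measurable_comp (@norm_continuous _ R) (mf i)).
Qed.

Lemma summable_on_norm_inf u w f : (forall i, summable_on u w (f^~ i)) ->
  summable_on u w (fun s => norm_inf (f s)).
Proof.
move=> sf; apply: (summable_on_le (k := fun s => \sum_i `|f s i|)).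
- by apply: measurable_norm_inf => i; exact: summable_on_measurable.
- move=> s _ _; rewrite ger0_norm ?norm_inf_ge0//.
  apply: norm_inf_le; first exact: sumr_ge0.
  by move=> i; rewrite (bigD1 i)//= ler_wpDr// sumr_ge0.
- by apply: summable_on_sum => i _; exact: summable_on_norm.
Qed.

Variables (a h : V -> V -> R -> R) (t0 : R).
Hypothesis t00 : 0 <= t0.
Hypothesis a_ge0 : forall i j t, 0 <= t -> 0 <= a i j t.
Hypothesis a_loc : forall i j, loc_summable (a i j).
Hypothesis h_ge0 : forall i j t, 0 <= t -> 0 <= h i j t.
Hypothesis h_meas : forall i j, lebesgue_measurable `[0, +oo[ (h i j).

Definition total_weight s := \sum_i \sum_(j | j != i) a i j s.

Lemma row_weight_le i s : 0 <= s ->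
  \sum_(j | j != i) a i j s <= total_weight s.
Proof.
move=> s0; rewrite /total_weight [leRHS](bigD1 i)//= lerDl; apply: sumr_ge0 => k _.
by apply: sumr_ge0 => j _; exact: a_ge0.
Qed.

Lemma summable_total_weight T : summable_on t0 T total_weight.
Proof.
by apply: summable_on_sum => i _; apply: summable_on_sum => j _; exact: loc_summable_on.
Qed.

(** Continuity is required on the whole line: it makes the delayed values
    [z (s - h i j s) j] measurable even when [s - h i j s < t0]. *)
Definition at_rest_before z : Prop :=
  (forall t i, t <= t0 -> z t i = 0) /\ forall i, continuous (z^~ i).

Lemma at_rest_bounded z T : at_rest_before z ->
  exists2 K, 0 <= K & forall s i, s <= T -> `|z s i| <= K.
Proof.
move=> [z0 cz].
have bnd i : exists K, forall s, s <= T -> `|z s i| <= K.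
  have [Tt|tT] := ltP T t0.
    by exists 0 => s sT; rewrite z0 ?normr0// ltW// (le_lt_trans sT).
  have [|c _ cP] := @EVT_max R (fun s => `|z s i|) t0 T tT.
    apply: continuous_subspaceT => s; apply: continuous_comp; first exact: cz.
    exact: norm_continuous.
  exists `|z c i| => s sT; have [st|ts] := leP s t0; first by rewrite z0// normr0.
  by apply: cP; rewrite in_itv/= ltW.
have [K KP] := choice bnd.
exists (\sum_i `|K i|) => [|s i sT]; first exact: sumr_ge0.
apply: le_trans (KP i s sT) _; apply: le_trans (ler_norm _) _.
by rewrite (bigD1 i)//= ler_wpDr// sumr_ge0.
Qed.

Lemma summable_rhs f z T : (forall i, loc_summable (f^~ i)) -> at_rest_before z ->
  forall i, summable_on t0 T (fun s => rhs a h f z s i).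
Proof.
move=> lf rz i; have [_ cz] := rz; have [K K0 zK] := at_rest_bounded T rz.
apply: summable_onD; last exact: loc_summable_on (lf i).
apply: summable_on_sum => j _.
apply: (summable_onM (K := K + K)).
- exact: loc_summable_on.
- apply: measurable_funB; last first.
    apply: (leb_measurable_fun (D := `]t0, T]%classic)) => //.
    by apply: measurable_funTS; exact: continuous_measurable_fun.
  apply: (@leb_measurable_comp _ _ (fun s => s - h i j s) (z^~ j)) => //.
  apply: measurable_funB.
    by apply: (leb_measurable_fun (D := `]t0, T]%classic)) => //.
  apply: measurable_funS (h_meas i j); first exact: leb_itv.
  by move=> s /=; rewrite !in_itv/= andbT => /andP[/ltW ts _]; exact: le_trans ts.
- move=> s ts sT; rewrite (le_trans (ler_normB _ _))// lerD// zK//.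
  have := h_ge0 i j (le_trans t00 (ltW ts)); lra.
Qed.

(** Its fixed points at rest before [t0] are the forced responses. *)
Definition picard f z t i := \int[leb]_(s in `]t0, t]) rhs a h f z s i.

Lemma at_rest_picard f z : (forall i, loc_summable (f^~ i)) ->
  at_rest_before z -> at_rest_before (picard f z).
Proof.
move=> lf rz; split => [t i tt0|i]; first exact: Rintegral_itv_ge.
by apply: continuous_primitive => T; exact: summable_rhs.
Qed.

Lemma picard_split f z u t i : (forall i, loc_summable (f^~ i)) ->
  at_rest_before z -> t0 <= u -> u <= t ->
  picard f z t i = picard f z u i + \int[leb]_(s in `]u, t]) rhs a h f z s i.
Proof.
move=> lf rz tu ut; apply: Rintegral_itv_split => //; exact: summable_rhs.
Qed.

(** The disturbance cancels in the difference, and both the delayed and the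
    instantaneous values contribute [d], whence the factor [2]. *)
Lemma picard_lipschitz f z z' u t i d : (forall i, loc_summable (f^~ i)) ->
  at_rest_before z -> at_rest_before z' -> t0 <= u -> u <= t ->
  (forall s j, s <= t -> `|z s j - z' s j| <= d) ->
  `|(picard f z t i - picard f z' t i) - (picard f z u i - picard f z' u i)| <=
  2 * d * \int[leb]_(s in `]u, t]) total_weight s.
Proof.
move=> lf rz rz' tu ut zd.
have sz : summable_on u t (fun s => rhs a h f z s i).
  by apply: (summable_onS tu (lexx t)); exact: summable_rhs.
have sz' : summable_on u t (fun s => rhs a h f z' s i).
  by apply: (summable_onS tu (lexx t)); exact: summable_rhs.
have st : summable_on u t total_weight.
  by apply: (summable_onS tu (lexx t)); exact: summable_total_weight.
rewrite (picard_split _ lf rz tu ut) (picard_split _ lf rz' tu ut).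
rewrite (_ : _ - _ - _ = \int[leb]_(s in `]u, t]) rhs a h f z s i -
  \int[leb]_(s in `]u, t]) rhs a h f z' s i); last by ring.
rewrite -RintegralB//; last exact: leb_itv.
have sB := summable_onB sz sz'.
apply: le_trans (le_normr_Rintegral (leb_itv _) sB) _.
rewrite -RintegralZl//; last exact: leb_itv.
apply: le_Rintegral_itv; [exact: summable_on_norm|exact: summable_onZ|].
move=> s us s_t.
have s0 : 0 <= s by rewrite (le_trans t00)// (le_trans tu)// ltW.
have d0 : 0 <= d by exact: le_trans (zd s i s_t).
have -> : rhs a h f z s i - rhs a h f z' s i = \sum_(j | j != i) a i j s *
    ((z (s - h i j s) j - z' (s - h i j s) j) - (z s i - z' s i)).
  rewrite /rhs opprD addrACA subrr addr0 -sumrB.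
  by apply: eq_bigr => j _; ring.
apply: le_trans (ler_norm_sum _ _ _) _.
apply: (@le_trans _ _ (\sum_(j | j != i) (2 * d) * a i j s)); last first.
  by rewrite -mulr_sumr ler_wpM2l ?mulr_ge0//; exact: row_weight_le.
apply: ler_sum => j _; rewrite normrM ger0_norm ?a_ge0// mulrC ler_wpM2r ?a_ge0//.
apply: le_trans (ler_normB _ _) _.
rewrite mulr_natl mulr2n lerD ?zd//.
have := h_ge0 i j s0; lra.
Qed.

End Forced.

(** * Advancing in time by small steps *)

Section Contraction.
Context {R : realType}.

Lemma interval_induction (P : R -> Prop) (t0 T : R) : t0 <= T ->
  (exists2 d, 0 < d & forall u t, t0 <= u -> u <= t -> t <= T -> t - u < d ->
     P u -> P t) ->
  P t0 -> P T.
Proof.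
move=> tT [d d0 step] P0.
pose n := (Num.truncn ((T - t0) / d)).+1.
have n0 : 0 < n%:R :> R by rewrite ltr0n.
pose e := (T - t0) / n%:R.
have e0 : 0 <= e by rewrite divr_ge0 ?subr_ge0// ltW.
have ed : e < d.
  by rewrite /e ltr_pdivrMr// mulrC -ltr_pdivrMr// truncnS_gt.
have eT : t0 + n%:R * e = T by rewrite /e mulrC divfK ?gt_eqF// subrKC.
suff H k : (k <= n)%N -> P (t0 + k%:R * e) by rewrite -eT; exact: H.
elim: k => [_|k IH kn]; first by rewrite mul0r addr0.
have ke : t0 + k.+1%:R * e = t0 + k%:R * e + e by rewrite -natr1; ring.
apply: (step _ _ _ _ _ _ (IH (ltnW kn))).
- by rewrite lerDl mulr_ge0.
- by rewrite ke lerDl.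
- by rewrite -eT lerD2l ler_wpM2r// ler_nat.
- by rewrite ke; lra.
Qed.

Lemma geometric_small (x M : R) : (forall k, x <= M * (3 / 4) ^+ k) -> x <= 0.
Proof.
move=> xM; have q1 : `|3 / 4 : R| < 1 by rewrite ger0_norm; lra.
by apply: (cvgr_to_ge (cvg_geometric M q1)); exact: nearW.
Qed.

Lemma geometric_cvg (u : R^nat) (C : R) : 0 <= C ->
  (forall k, `|u k.+1 - u k| <= C * (3 / 4) ^+ k) ->
  cvgn u /\ forall k, `|limn u - u k| <= 4 * C * (3 / 4) ^+ k.
Proof.
move=> C0 uC; have q1 : `|3 / 4 : R| < 1 by rewrite ger0_norm; lra.
have cu : cvgn u.
  rewrite (_ : u = fun n => u 0%N + series (telescope u) n); last first.
    by apply/funext => n; exact: eq_sum_telescope.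
  apply: is_cvgD; first exact: is_cvg_cst.
  apply: normed_cvg; apply: (series_le_cvg (v_ := geometric C (3 / 4))).
  - by move=> n /=.
  - by move=> n /=; rewrite mulr_ge0// exprn_ge0//; lra.
  - by move=> n /=; exact: uC.
  - exact: is_cvg_geometric_series.
split=> // k.
have tail n : `|u (k + n)%N - u k| <= 4 * C * ((3 / 4) ^+ k - (3 / 4) ^+ (k + n)).
  elim: n => [|n IH]; first by rewrite addn0 !subrr normr0 mulr0.
  rewrite addnS -(subrKA (u (k + n)%N)) (le_trans (ler_normD _ _))//.
  apply: le_trans (lerD (uC _) IH) _; rewrite exprS.
  by rewrite le_eqVlt; apply/orP; left; apply/eqP; field.
have cvk : `|u (k + n)%N - u k| @[n --> \oo] --> `|limn u - u k|.
  apply: cvg_norm; apply: cvgB; last exact: cvg_cst.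
  rewrite (_ : (fun n => u (k + n)%N) = (fun n => u (n + k)%N)).
    by rewrite cvg_shiftn.
  by apply/funext => n; rewrite addnC.
apply: (cvgr_to_le cvk); apply: nearW => n; apply: le_trans (tail n) _.
rewrite ler_wpM2l ?mulr_ge0// lerBlDr lerDl exprn_ge0//; lra.
Qed.

End Contraction.

(** Isolates the final excursion of a component above its bound, during which its
    own value can be bounded below. *)
Lemma last_nonpos {R : realType} (g : R -> R) (u s : R) : u <= s -> continuous g ->
  g u <= 0 -> exists s0, [/\ u <= s0, s0 <= s, g s0 <= 0 &
    forall r, s0 < r -> r <= s -> 0 < g r].
Proof.
move=> us cg gu; pose A := [set r | [/\ u <= r, r <= s & g r <= 0]].
have Au : A u by split.
have ubA : ubound A s by move=> r [].
have sA : has_sup A by split; [exists u|exists s].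
exists (sup A); split.
- by apply: ub_le_sup => //; exists s.
- by apply: ge_sup => //; exists u.
- rewrite leNgt; apply/negP => g0.
  have /nbhs_ballP[e /= e0 eP] : \forall y \near sup A, 0 < g y.
    have /cvgrPdist_lt/(_ _ g0) := cg (sup A); apply: filterS => y.
    by rewrite ltr_norml => /andP[_]; lra.
  have [r Ar rA] := sup_adherent e0 sA.
  have rS : r <= sup A by apply: ub_le_sup => //; exists s.
  have := eP r; rewrite /ball/= ger0_norm ?subr_ge0// ltrBlDl -ltrBlDr.
  move=> /(_ rA).
  by case: Ar => _ _; rewrite leNgt => /negP.
- move=> r Sr rs; rewrite ltNge; apply/negP => gr.
  suff : r <= sup A by rewrite leNgt Sr.
  apply: ub_le_sup; first by exists s.
  split => //; apply: le_trans (ltW Sr).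
  by apply: ub_le_sup => //; exists s.
Qed.

(** * Existence of the forced response and its maximum principle *)

Section ForcedResponse.
Context {R : realType} {V : finType}.
Implicit Types (t s u w T K : R) (f z : R -> V -> R) (v : V -> R).
Variables (a h : V -> V -> R -> R) (t0 : R).
Hypothesis t00 : 0 <= t0.
Hypothesis a_ge0 : forall i j t, 0 <= t -> 0 <= a i j t.
Hypothesis a_loc : forall i j, loc_summable (a i j).
Hypothesis h_ge0 : forall i j t, 0 <= t -> 0 <= h i j t.
Hypothesis h_meas : forall i j, lebesgue_measurable `[0, +oo[ (h i j).

Lemma total_weight_small T : t0 <= T -> exists2 d, 0 < d &
  forall u t, t0 <= u -> u <= t -> t <= T -> t - u < d ->
    \int[leb]_(s in `]u, t]) total_weight a s <= 1 / 4.
Proof.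
move=> tT.
have sw := summable_total_weight t00 a_loc T.
have [|d d0 dP] := Rintegral_itv_small tT sw (e := 1 / 4); first by lra.
exists d => // u t tu ut tT' utd; apply: le_trans (ltW (dP u t tu ut tT' utd)).
have swt : summable_on u t (total_weight a) by exact: summable_onS sw.
apply: le_Rintegral_itv => // [|s _ _]; first exact: summable_on_norm.
exact: ler_norm.
Qed.

Section Existence.
Variable f : R -> V -> R.
Hypothesis f_loc : forall i, loc_summable (f^~ i).

Let it k := iter k (picard a h t0 f) (fun _ _ => 0).

Let it_rest k : at_rest_before t0 (it k).
Proof.
elim: k => [|k IH]; first by split => // i t; exact: cvg_cst.
exact: at_rest_picard.
Qed.

(** Over a step of total weight at most [1 / 4] the Picard operator halves
    distances, up to the distance already accumulated before the step.  The rate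
    [3 / 4 > 1 / 2] leaves room to absorb the latter in the constant. *)
Let it_contraction T : t0 <= T -> exists2 C, 0 <= C &
  forall k t i, t <= T -> `|it k.+1 t i - it k t i| <= C * (3 / 4) ^+ k.
Proof.
move=> tT.
apply: (interval_induction (P := fun u => exists2 C, 0 <= C &
  forall k t i, t <= u -> `|it k.+1 t i - it k t i| <= C * (3 / 4) ^+ k) tT);
  last first.
  exists 0 => // k t i tt0.
  by rewrite (it_rest k.+1).1// (it_rest k).1// subrr normr0 mul0r.
have [d d0 dP] := total_weight_small tT.
exists d => // u w tu uw wT uwd [C C0 CP].
have [K K0 KP] := at_rest_bounded w (it_rest 1).
have q0 k : 0 <= (3 / 4 : R) ^+ k by rewrite exprn_ge0//; lra.
(* [C' := 3 C + K] satisfies [3 / 4 C + 1 / 2 C' <= 3 / 4 C']; the summand [K]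
   bounds the first iterate. *)
exists (3 * C + K); first by rewrite addr_ge0 ?mulr_ge0.
elim=> [|k IH] t i tw.
  by rewrite expr0 mulr1 subr0; apply: le_trans (KP t i tw) _; rewrite lerDr mulr_ge0.
have [t_u|/ltW u_t] := leP t u.
  by apply: le_trans (CP _ _ i t_u) _; rewrite ler_wpM2r//; lra.
have L := @picard_lipschitz R V a h t0 t00 a_ge0 a_loc h_ge0 h_meas f
  (it k.+1) (it k) u t i _
  f_loc (it_rest _) (it_rest _) tu u_t (fun s j st => IH s j (le_trans st tw)).
have W : \int[leb]_(s in `]u, t]) total_weight a s <= 1 / 4.
  apply: dP => //; [exact: le_trans wT|lra].
have W0 : 0 <= (3 * C + K) * (3 / 4) ^+ k by rewrite mulr_ge0// addr_ge0// mulr_ge0.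
have {}L := le_trans L (ler_wpM2l (mulr_ge0 (ler0n _ 2) W0) W).
have Cu := CP k.+1 u i (lexx u).
rewrite -[X in `|X|](subrK (it k.+2 u i - it k.+1 u i)) (le_trans (ler_normD _ _))//.
apply: le_trans (lerD L Cu) _.
have := mulr_ge0 K0 (q0 k); rewrite exprS; lra.
Qed.

(** The pointwise limit of the Picard iterates; convergence is uniform on every
    half-line [t <= T], hence the limit is continuous and a fixed point. *)
Lemma forced_response_exists : exists z,
  at_rest_before t0 z /\ forall t i, z t i = picard a h t0 f z t i.
Proof.
pose z t i := limn (fun k => it k t i).
have rate T : exists2 C, 0 <= C & forall k t i, t <= T ->
    `|z t i - it k t i| <= C * (3 / 4) ^+ k.
  have tm : t0 <= Num.max t0 T by rewrite le_max lexx.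
  have [C C0 CP] := it_contraction tm.
  exists (4 * C) => [|k t i tT]; first by rewrite mulr_ge0.
  have [] := @geometric_cvg R (fun k => it k t i) C C0 _; last by [].
  by move=> m; apply: CP; rewrite le_max tT orbT.
have rz : at_rest_before t0 z.
  split => [t i tt0|i t].
    rewrite /z (_ : (fun k => it k t i) = cst 0) ?lim_cst//.
    by apply/funext => k; rewrite (it_rest k).1.
  have [C C0 CP] := rate (t + 1).
  apply/cvgrPdist_lt => e e0.
  have [k kP] : exists k, C * (3 / 4) ^+ k < e / 3.
    apply: contrapT => /forallNP nk.
    suff : e / 3 <= 0 by lra.
    by apply: (@geometric_small R _ C) => k; rewrite leNgt; apply/negP.
  have ck : continuous ((it k)^~ i) by exact: (it_rest k).2.
  have /cvgrPdist_lt/(_ (e / 3)) := ck t; rewrite divr_gt0// => /(_ isT) ckt.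
  near=> y.
  have y1 : y <= t + 1.
    have : `|t - y| < 1 by near: y; apply/nbhs_ballP; exists 1 => //=.
    by rewrite ltr_norml => /andP[]; lra.
  have H1 := le_lt_trans (CP k t i (ltW (ltr_pwDr ltr01 (lexx t)))) kP.
  have H2 := le_lt_trans (CP k y i y1) kP.
  have H3 : `|it k t i - it k y i| < e / 3 by near: y.
  rewrite (_ : z t i - z y i = (z t i - it k t i) + (it k t i - it k y i) -
    (z y i - it k y i)); last by ring.
  apply: le_lt_trans (ler_normB _ _) _.
  apply: le_lt_trans (lerD (ler_normD _ _) (lexx _)) _; lra.
exists z; split=> // t i.
have [tt0|/ltW t0t] := leP t t0.
  by rewrite rz.1// (at_rest_picard t00 a_loc h_ge0 h_meas f_loc rz).1.
have [C C0 CP] := rate t.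
apply/eqP; rewrite -subr_eq0 -normr_le0.
pose W := \int[leb]_(s in `]t0, t]) total_weight a s.
apply: (@geometric_small _ _ (C + 2 * C * W)) => k.
have L := @picard_lipschitz R V a h t0 t00 a_ge0 a_loc h_ge0 h_meas f
  z (it k) t0 t i _
  f_loc rz (it_rest _) (lexx _) t0t (fun s j st => CP k s j st).
have P0 g : at_rest_before t0 g -> picard a h t0 f g t0 i = 0.
  by move=> rg; rewrite (at_rest_picard t00 a_loc h_ge0 h_meas f_loc rg).1.
rewrite !P0// subrr subr0 in L.
have := CP k.+1 t i (lexx t) => /= Ck.
rewrite -(subrKA (picard a h t0 f (it k) t i)).
apply: le_trans (ler_normD _ _) _; rewrite [X in _ + X]distrC.
apply: le_trans (lerD Ck L) _.
have q0 : 0 <= C * (3 / 4 : R) ^+ k by rewrite mulr_ge0// exprn_ge0//; lra.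
rewrite exprS -/W; lra.
Unshelve. all: by end_near. Qed.

End Existence.


Definition disturbance_mass f t := \int[leb]_(s in `]t0, t]) norm_inf (f s).

Section Bound.
Variables (f z : R -> V -> R).
Hypothesis f_loc : forall i, loc_summable (f^~ i).
Hypothesis z_rest : at_rest_before t0 z.
Hypothesis z_fix : forall t i, z t i = picard a h t0 f z t i.

Let F := disturbance_mass f.

Let summable_f T : summable_on t0 T (fun s => norm_inf (f s)).
Proof. by apply: summable_on_norm_inf => i; exact: loc_summable_on. Qed.

Let F_ge0 t : 0 <= F t.
Proof. by apply: Rintegral_ge0 => s _; exact: norm_inf_ge0. Qed.

Let F_split s t : t0 <= s -> s <= t ->
  F t = F s + \int[leb]_(r in `]s, t]) norm_inf (f r).
Proof. by move=> ts st; apply: Rintegral_itv_split => //; exact: summable_f. Qed.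

Let F_mono s t : s <= t -> F s <= F t.
Proof.
move=> st; have [ts|/ltW ts] := leP s t0.
  by rewrite [F s]Rintegral_itv_ge.
by rewrite (F_split ts st) lerDl Rintegral_ge0// => r _; exact: norm_inf_ge0.
Qed.

(** The excess of [z] over [F] is shown to shrink geometrically.  Suppose all
    components are at most [F + M] up to the end of a step.  If [s0] is the last
    time where component [j] does not exceed [F], then after [s0] each
    neighbour is at most [F + M] while component [j] is at least [F], so
    component [j] grows by at most [M] times the total weight plus the growth of
    [F]; at the end of the step its excess is at most [M / 4]. *)
Lemma forced_response_upper t i : z t i <= F t.
Proof.
have [tt0|/ltW t0t] := leP t t0; first by rewrite z_rest.1.
suff : forall s i, s <= t -> z s i <= F s by apply.
apply: (interval_induction (P := fun u => forall s i, s <= u -> z s i <= F s) t0t);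
  last by move=> s j st; rewrite z_rest.1.
have [d d0 dP] := total_weight_small t0t.
exists d => // u w tu uw wt uwd IH.
have [K K0 KP] := at_rest_bounded w z_rest.
have decay k : forall s j, s <= w -> z s j <= F s + K * (3 / 4) ^+ k.
  elim: k => [|k IHk] s j sw.
    rewrite expr0 mulr1; apply: le_trans (ler_norm _) _.
    by apply: le_trans (KP _ _ sw) _; rewrite lerDr.
  pose M := K * (3 / 4) ^+ k.
  have M0 : 0 <= M by rewrite mulr_ge0// exprn_ge0//; lra.
  have ME : K * (3 / 4) ^+ k.+1 = 3 / 4 * M by rewrite exprS /M; ring.
  have [su|/ltW us] := leP s u.
    by apply: le_trans (IH s j su) _; rewrite lerDl ME mulr_ge0//; lra.
  have cg : continuous (fun r => z r j - F r).
    move=> r; apply: cvgB; first exact: z_rest.2.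
    apply: (continuous_primitive (g := fun s => norm_inf (f s))) => T.
    exact: summable_f.
  have gu : z u j - F u <= 0 by rewrite subr_le0 IH.
  have [s0 [us0 s0s gs0 gpos]] := last_nonpos us cg gu.
  have ts0 := le_trans tu us0.
  have zs : z s j = z s0 j + \int[leb]_(r in `]s0, s]) rhs a h f z r j.
    by rewrite [LHS]z_fix [in RHS]z_fix; exact: picard_split.
  have sw0 : summable_on s0 s (total_weight a).
    by apply: (summable_onS ts0 (lexx s)); exact: summable_total_weight.
  have sf0 : summable_on s0 s (fun r => norm_inf (f r)).
    by apply: (summable_onS ts0 (lexx s)); exact: summable_f.
  have I1 : \int[leb]_(r in `]s0, s]) rhs a h f z r j <=
      M * (1 / 4) + (F s - F s0).
    rewrite (F_split ts0 s0s) addrAC subrr add0r.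
    apply: (@le_trans _ _ (\int[leb]_(r in `]s0, s])
      (M * total_weight a r + norm_inf (f r)))).
      apply: le_Rintegral_itv.
      - by apply: (summable_onS ts0 (lexx s)); exact: summable_rhs.
      - by apply: summable_onD => //; exact: summable_onZ.
      move=> r s0r rs.
      have r0 : 0 <= r by rewrite (le_trans t00)// (le_trans ts0)// ltW.
      apply: lerD; last by apply: le_trans (ler_norm _) _; exact: norm_inf_ge.
      apply: (@le_trans _ _ (\sum_(k | k != j) M * a j k r)); last first.
        by rewrite -mulr_sumr ler_wpM2l//; exact: row_weight_le.
      apply: ler_sum => l _; rewrite mulrC ler_wpM2r ?a_ge0//.
      have hr : r - h j l r <= r by have := h_ge0 j l r0; lra.
      have := IHk (r - h j l r) l (le_trans hr (le_trans rs sw)).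
      have := F_mono hr; have := gpos r s0r rs; rewrite -/M; lra.
    rewrite RintegralD; [|exact: leb_itv|exact: summable_onZ|exact: sf0].
    rewrite RintegralZl; [|exact: leb_itv|exact: sw0].
    by rewrite lerD2r ler_wpM2l// dP//; [exact: le_trans wt|lra].
  rewrite ME zs; lra.
move=> s j sw; rewrite -subr_le0.
by apply: (@geometric_small _ _ K) => k; rewrite lerBlDl; exact: decay.
Qed.

End Bound.

Lemma picardN f z t i : (forall i, loc_summable (f^~ i)) ->
  at_rest_before t0 z ->
  picard a h t0 (fun s j => - f s j) (fun s j => - z s j) t i =
  - picard a h t0 f z t i.
Proof.
move=> lf rz; rewrite -mulN1r -RintegralZl; [|exact: leb_itv|exact: summable_rhs].
congr fine; apply: eq_integral => s _; congr EFin.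
rewrite mulN1r /rhs opprD -sumrN; congr (_ + _).
by apply: eq_bigr => j _; ring.
Qed.

Lemma forced_response_bound f z : (forall i, loc_summable (f^~ i)) ->
  at_rest_before t0 z -> (forall t i, z t i = picard a h t0 f z t i) ->
  forall t i, `|z t i| <= disturbance_mass f t.
Proof.
move=> lf rz zP t i; rewrite ler_norml; apply/andP; split; last first.
  exact: forced_response_upper.
rewrite lerNl.
have -> : disturbance_mass f t = disturbance_mass (fun s j => - f s j) t.
  apply: eq_Rintegral => s _; apply: eq_bigr => j _; by rewrite normrN.
apply: (@forced_response_upper (fun s j => - f s j) (fun s j => - z s j)).
- move=> j T T0; have := integrableN (lf j T T0).
  apply: eq_integrable => //; exact: leb_itv.
- split => [s j st|j s]; first by rewrite rz.1// oppr0.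
  by apply: cvgN; exact: rz.2.
- by move=> s j; rewrite picardN// -zP.
Qed.

End ForcedResponse.

(** * Restarting solutions and removing the disturbance *)

Section Solutions.
Context {R : realType} {V : finType}.
Implicit Types (t s u w T K : R) (f x z : R -> V -> R) (v : V -> R).
Variables (hbar : R) (a h : V -> V -> R -> R).

Lemma solution_continuous_max f tstar x i : solution hbar a h f tstar x ->
  continuous (fun t => x (Num.max tstar t) i).
Proof.
move=> [_ _ ac _]; apply: (abs_continuous_continuous_max (x := x^~ i)) => T.
exact: ac.
Qed.

Lemma solution_bounded f tstar x T : solution hbar a h f tstar x ->
  exists2 K, 0 <= K & forall s i, tstar - hbar <= s -> s <= T -> `|x s i| <= K.
Proof.
move=> sx; have [_ [K0 K0P] _ _] := sx.
have bnd i : exists K, forall s, tstar <= s -> s <= T -> `|x s i| <= K.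
  have [Tt|tT] := ltP T tstar.
    by exists 0 => s ts sT; have := le_trans ts sT; rewrite leNgt Tt.
  have [|c _ cP] := @EVT_max R (fun s => `|x (Num.max tstar s) i|) tstar T tT.
    apply: continuous_subspaceT => s; apply: continuous_comp;
      last exact: norm_continuous.
    exact: (solution_continuous_max sx).
  exists `|x (Num.max tstar c) i| => s ts sT.
  by have := cP s; rewrite in_itv/= ts sT (max_r ts); apply.
have [K KP] := choice bnd.
exists (`|K0| + \sum_i `|K i|) => [|s i hs sT]; first by rewrite addr_ge0// sumr_ge0.
have [st|ts] := ltP s tstar.
  apply: le_trans (K0P s i hs st) _; apply: le_trans (ler_norm _) _.
  by rewrite lerDl sumr_ge0.
apply: le_trans (KP i s ts sT) _; apply: le_trans (ler_norm _) _.
by rewrite (bigD1 i)//= addrCA lerDl addr_ge0// sumr_ge0.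
Qed.

(** On the new prehistory, [x] is partly the old prehistory, which is
    measurable, and partly the solution itself, which is continuous. *)
Lemma solution_restart f tstar t1 x : tstar <= t1 ->
  solution hbar a h f tstar x -> solution hbar a h f t1 x.
Proof.
move=> tt1 sx; have [mx _ ac dx] := sx; split.
- move=> i.
  have sub : `[t1 - hbar, t1[ `<=` `[tstar - hbar, tstar[ `|` `[tstar, t1[.
    move=> s /=; rewrite !in_itv/= => /andP[h1 h2].
    have [st|ts] := ltP s tstar; last by right; apply/andP.
    by left; apply/andP; split => //; rewrite (le_trans _ h1)// lerB.
  have mU : measurable (`[tstar - hbar, tstar[ `|` `[tstar, t1[
      : set (lebesgueType R)) by apply: measurableU; exact: leb_itv.
  apply: (measurable_funS mU sub).
  apply/measurable_funU; try exact: leb_itv.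
  split; first exact: mx.
  apply: (@eq_measurable_fun _ _ (lebesgueType R) R _
    (fun s => x (Num.max tstar s) i)).
    by move=> s /set_mem/=; rewrite in_itv/= => /andP[ts _]; rewrite max_r.
  apply: (leb_measurable_fun (D := `[tstar, t1[%classic)) => //.
  apply: measurable_funTS; apply: continuous_measurable_fun.
  exact: (solution_continuous_max sx).
- have [K _ KP] := solution_bounded t1 sx.
  exists K => s i hs st; apply: KP; last exact: ltW.
  by rewrite (le_trans _ hs)// lerB.
- move=> T i t1T e e0; have [d d0 dP] := ac T i (le_trans tt1 t1T) e e0.
  exists d => // n u w uw; apply: dP => k.
  by have [tu uwk] := uw k; split => //; exact: le_trans tu.
- move=> i; have := dx i; apply: filterS; first exact: (ae_filter_ringOfSetsType leb).
  by move=> t H t1t; apply: H; exact: le_lt_trans t1t.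
Qed.

Lemma solution_sub_forced f t0 x z : 0 <= t0 ->
  (forall i j, loc_summable (a i j)) ->
  (forall i j t, 0 <= t -> 0 <= h i j t) ->
  (forall i j, lebesgue_measurable `[0, +oo[ (h i j)) ->
  (forall i, loc_summable (f^~ i)) ->
  at_rest_before t0 z -> (forall t i, z t i = picard a h t0 f z t i) ->
  solution hbar a h f t0 x ->
  solution hbar a h (fun _ _ => 0) t0 (fun t i => x t i - z t i).
Proof.
move=> t00 la h0 mh lf rz zP [mx [K KP] ac dx].
have sr i T : summable_on t0 T (fun s => rhs a h f z s i) by exact: summable_rhs.
have zE i : z^~ i = (fun t => \int[leb]_(s in `]t0, t]) rhs a h f z s i).
  by apply/funext => t; exact: zP.
split.
- move=> i; apply: measurable_funB; first exact: mx.
  apply: (leb_measurable_fun (D := `[t0 - hbar, t0[%classic)) => //.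
  by apply: measurable_funTS; apply: continuous_measurable_fun; exact: rz.2.
- exists K => s i hs st; rewrite rz.1 ?subr0; [exact: KP|exact: ltW].
- move=> T i tT e e0; have e2 : 0 < e / 2 by lra.
  have [d d0 dP] := ac T i tT _ e2.
  have acz : abs_continuous t0 T (z^~ i).
    by rewrite zE; exact: abs_continuous_primitive.
  have [d' d'0 d'P] := acz _ e2.
  exists (Num.min d d') => [|n u w uw triv]; first by rewrite lt_min d0.
  rewrite lt_min => /andP[sd sd'].
  have := dP n u w uw triv sd; have := d'P n u w uw triv sd'.
  set S' := \sum_(k < n) _; set S := \sum_(k < n) _ => S'2 S2.
  apply: (@le_lt_trans _ _ (S + S')); last by lra.
  rewrite /S /S' -big_split/=; apply: ler_sum => k _.
  rewrite (_ : _ - _ = (x (w k) i - x (u k) i) - (z (w k) i - z (u k) i));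
    last by ring.
  exact: ler_normB.
- move=> i; have dz := leb_FTC (sr i); rewrite -zE in dz.
  apply: filterS2 (dx i) dz; first exact: (ae_filter_ringOfSetsType leb).
  move=> t dxt dzt tt0; have D := is_deriveB (dxt tt0) (dzt tt0).
  suff -> : rhs a h (fun _ _ => 0) (fun t i => x t i - z t i) t i =
    rhs a h f x t i - rhs a h f z t i by exact: D.
  have cancel (A B C : R) : A + C - (B + C) = A - B by ring.
  rewrite /rhs addr0 cancel -sumrB.
  by apply: eq_bigr => j _; ring.
Qed.

End Solutions.

(** * Contraction of the spread over one period *)

Section Spread.
Context {R : realType} {V : finType}.
Implicit Types (t s u w T K d : R) (f x y z : R -> V -> R) (v : V -> R).
Variable i0 : V.

Lemma vmax_le v K : (forall i, v i <= K) -> vmax v <= K.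
Proof. by move=> vK; apply: ge_sup => [|_ [i _ <-]//]; exists (v i0), i0. Qed.

Lemma vmin_ge v K : (forall i, K <= v i) -> K <= vmin v.
Proof. by move=> vK; apply: lb_le_inf => [|_ [i _ <-]//]; exists (v i0), i0. Qed.

Lemma vmax_ge v i : v i <= vmax v.
Proof.
apply: ub_le_sup; last by exists i.
exists (norm_inf v) => _ [j _ <-].
by apply: le_trans (norm_inf_ge v j); exact: ler_norm.
Qed.

Lemma vmin_le v i : vmin v <= v i.
Proof.
apply: ge_inf; last by exists i.
exists (- norm_inf v) => _ [j _ <-]; rewrite lerNl.
by apply: le_trans (norm_inf_ge v j); rewrite -normrN; exact: ler_norm.
Qed.

Lemma vmax_vmin_ge0 v : 0 <= vmax v - vmin v.
Proof. by rewrite subr_ge0 (le_trans (vmin_le v i0))// vmax_ge. Qed.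

Lemma dist_le_vmax_vmin v i j : `|v i - v j| <= vmax v - vmin v.
Proof.
have := vmax_ge v i; have := vmax_ge v j; have := vmin_le v i.
by have := vmin_le v j; rewrite ler_norml => ? ? ? ?; apply/andP; split; lra.
Qed.

Variable hbar : R.
Hypothesis hbar_ge0 : 0 <= hbar.

Definition spread x t := Lambda hbar x t - lambda hbar x t.

Let window_self t : `[t - hbar, t]%classic t.
Proof. by rewrite /= in_itv/= lexx gerBl hbar_ge0. Qed.

Lemma Lambda_ge x t K : (forall s i, t - hbar <= s -> s <= t -> `|x s i| <= K) ->
  forall s i, t - hbar <= s -> s <= t -> x s i <= Lambda hbar x t.
Proof.
move=> xK s i hs st; apply: le_trans (vmax_ge (x s) i) _.
apply: ub_le_sup; last by exists s => //=; rewrite in_itv/= hs.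
exists K => y [r /=]; rewrite in_itv/= => /andP[hr rt] <-.
by apply: vmax_le => j; apply: le_trans (ler_norm _) _; exact: xK.
Qed.

Lemma lambda_le x t K : (forall s i, t - hbar <= s -> s <= t -> `|x s i| <= K) ->
  forall s i, t - hbar <= s -> s <= t -> lambda hbar x t <= x s i.
Proof.
move=> xK s i hs st; apply: le_trans _ (vmin_le (x s) i).
apply: ge_inf; last by exists s => //=; rewrite in_itv/= hs.
exists (- K) => y [r /=]; rewrite in_itv/= => /andP[hr rt] <-.
by apply: vmin_ge => j; have := xK r j hr rt; rewrite ler_norml => /andP[].
Qed.

Lemma spread_perturb x y t d K :
  (forall s i, t - hbar <= s -> s <= t -> `|y s i| <= K) ->
  (forall s i, t - hbar <= s -> s <= t -> `|x s i - y s i| <= d) ->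
  spread x t <= spread y t + 2 * d.
Proof.
move=> yK xyd.
have L : Lambda hbar x t <= Lambda hbar y t + d.
  apply: ge_sup; first by exists (vmax (x t)), t.
  move=> y0 [s /=]; rewrite in_itv/= => /andP[hs st] <-; apply: vmax_le => i.
  have := Lambda_ge yK i hs st; have := xyd s i hs st.
  by rewrite ler_norml => /andP[]; lra.
have l : lambda hbar y t - d <= lambda hbar x t.
  apply: lb_le_inf; first by exists (vmin (x t)), t.
  move=> y0 [s /=]; rewrite in_itv/= => /andP[hs st] <-; apply: vmin_ge => i.
  have := lambda_le yK i hs st; have := xyd s i hs st.
  by rewrite ler_norml => /andP[]; lra.
rewrite /spread; lra.
Qed.

Lemma vmax_vmin_le_spread x t K :
  (forall s i, t - hbar <= s -> s <= t -> `|x s i| <= K) ->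
  vmax (x t) - vmin (x t) <= spread x t.
Proof.
move=> xK; have ht : t - hbar <= t by rewrite gerBl.
apply: lerB.
  by apply: vmax_le => i; exact: (Lambda_ge xK).
by apply: vmin_ge => i; exact: (lambda_le xK).
Qed.

End Spread.

(** The factor [8 = 2 * 4] counts the two ends of the spread and the [4 m]
    intervals of a period, with [m <= #|V|]. *)
Definition gain {R : realType} (V : finType) (theta : R) : R :=
  8 * #|V|%:R / (1 - theta).

Lemma gain_gt0 {R : realType} (V : finType) (theta : R) :
  V -> theta < 1 -> 0 < gain V theta.
Proof.
move=> i0 th1; have V0 : 0 < #|V|%:R :> R.
  by rewrite ltr0n; apply/card_gt0P; exists i0.
by apply: divr_gt0; [exact: mulr_gt0 (ltr0n _ 8) V0|rewrite subr_gt0].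
Qed.

Section Disturbed.
Context {R : realType} {V : finType}.
Implicit Types (t s u w T K d : R) (x y z : R -> V -> R) (v : V -> R).
Variables (i0 : V) (hbar : R) (a h : V -> V -> R -> R) (tp : nat -> R) (theta : R).
Hypothesis hbar_ge0 : 0 <= hbar.
Hypothesis a_ge0 : forall i j t, 0 <= t -> 0 <= a i j t.
Hypothesis a_loc : forall i j, loc_summable (a i j).
Hypothesis h_ge0 : forall i j t, 0 <= t -> 0 <= h i j t.
Hypothesis h_meas : forall i j, lebesgue_measurable `[0, +oo[ (h i j).
Hypothesis tp_ge0 : forall p, 0 <= tp p.
Hypothesis tp_mono : {homo tp : p q / (p <= q)%N >-> p <= q}.
Hypothesis tp_y : tp @ \oo --> +oo.
Hypothesis theta_gt0 : 0 < theta.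
Hypothesis theta_lt1 : theta < 1.
Hypothesis theta_rate : contraction_rate hbar a h tp theta.
Variable f : R -> V -> R.
Hypothesis f_loc : forall i, loc_summable (f^~ i).

Let m := #|V|.-1.
Let J p := \int[leb]_(t in `]tp p, tp p.+1]) norm_inf (f t).

Let J_ge0 p : 0 <= J p.
Proof. by apply: Rintegral_ge0 => s _; exact: norm_inf_ge0. Qed.

Let summable_f u w : 0 <= u -> summable_on u w (fun s => norm_inf (f s)).
Proof.
by move=> u0; apply: summable_on_norm_inf => i; exact: loc_summable_on.
Qed.

Lemma disturbance_mass_le r n I : (forall p, (r <= p)%N -> J p <= I) ->
  disturbance_mass (tp r) f (tp (r + n)) <= n%:R * I.
Proof.
move=> JI; elim: n => [|n IH].
  by rewrite addn0 mul0r /disturbance_mass Rintegral_itv_ge.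
rewrite /disturbance_mass addnS (@Rintegral_itv_split _ _ _ (tp (r + n))).
- by rewrite -natr1 mulrDl mul1r lerD// JI// leq_addr.
- by apply: tp_mono; rewrite leq_addr.
- exact: tp_mono.
- exact: summable_f.
Qed.

(** Only the interval [[tp (r + 2 m), tp (r + 4 m)]], on which the undisturbed
    solution restarted at [tp r] has contracted exactly once, is used.  The
    disturbance shifts both ends of the spread by at most its mass, whence the
    factor [2]. *)
Lemma period_contraction tstar x r I t :
  solution hbar a h f tstar x -> tstar <= tp r ->
  (forall p, (r <= p)%N -> J p <= I) ->
  tp (r + 2 * m) <= t -> t <= tp (r + 4 * m) ->
  spread hbar x t <= theta * spread hbar x (tp r) + 2 * ((4 * m)%:R * I).
Proof.
move=> sx tr JI rt tr'.
have sx' := solution_restart tr sx.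
have [z [rz zP]] :=
  forced_response_exists (tp_ge0 r) a_ge0 a_loc h_ge0 h_meas f_loc.
have zb :=
  forced_response_bound (tp_ge0 r) a_ge0 a_loc h_ge0 h_meas f_loc rz zP.
pose y t i := x t i - z t i.
have sy : solution hbar a h (fun _ _ => 0) (tp r) y.
  exact: solution_sub_forced sx'.
have rt' : tp r <= t by apply: le_trans rt; apply: tp_mono; rewrite leq_addr.
have [K _ yK] := solution_bounded t sy.
have [K' _ xK] := solution_bounded t sx'.
have mono s : s <= t -> disturbance_mass (tp r) f s <= (4 * m)%:R * I.
  move=> st; apply: le_trans (disturbance_mass_le (4 * m) JI).
  rewrite /disturbance_mass /Rintegral fine_le//.
  - by apply: integrable_fin_num; [exact: leb_itv|exact: summable_f].
  - by apply: integrable_fin_num; [exact: leb_itv|exact: summable_f].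
  apply: ge0_subset_integral; try exact: leb_itv.
  - by apply: measurable_int; exact: summable_f.
  - by move=> s' _; rewrite lee_fin norm_inf_ge0.
  - by apply: subset_itvl; rewrite bnd_simp (le_trans st).
have P1 : spread hbar x t <= spread hbar y t + 2 * ((4 * m)%:R * I).
  apply: (spread_perturb i0 hbar_ge0 (K := K)).
    by move=> s i hs st; apply: yK => //; rewrite (le_trans _ hs)// lerB.
  move=> s i _ st; rewrite /y subKr; apply: le_trans (zb s i) _; exact: mono.
have P2 : spread hbar y (tp r) <= spread hbar x (tp r).
  rewrite -[leRHS]addr0 -(mulr0 2).
  apply: (spread_perturb i0 hbar_ge0 (K := K')).
    by move=> s i hs st; apply: xK => //; exact: le_trans rt'.
  by move=> s i _ st; rewrite /y rz.1// subr0 subrr normr0.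
have [xbar [_ rate]] := theta_rate (tp_ge0 r) sy.
have [_] := rate r 1%N t (lexx _) rt tr'.
rewrite expr1 -!/(spread _ _ _) => P3.
have := ler_wpM2l (ltW theta_gt0) P2; lra.
Qed.

Let gain_ge0 : 0 <= gain V theta.
Proof. by apply: ltW; exact: gain_gt0. Qed.

(** With [b = 8 m I], iterating [E |-> theta E + b] converges to
    [B = b / (1 - theta) <= gain I].  For a single agent ([m = 0]) the periods
    degenerate to points and do not cover the time axis, but there is nothing to
    agree upon. *)
Lemma disagreement_eventually tstar x N I :
  solution hbar a h f tstar x -> (forall p, (N <= p)%N -> J p <= I) ->
  forall e, 0 < e ->
    exists M, forall t, M < t -> vmax (x t) - vmin (x t) <= gain V theta * I + e.
Proof.
move=> sx JI e e0.
have I0 : 0 <= I by apply: le_trans (J_ge0 N) (JI N (leqnn N)).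
have gI0 : 0 <= gain V theta * I by exact: mulr_ge0.
have [m0|m0] := posnP m.
  exists 0 => t _; apply: (@le_trans _ _ 0); last by rewrite addr_ge0// ltW.
  have card1 : (#|V| <= 1)%N by move: m0; rewrite /m; case: #|V| => [|[]].
  have all0 i : i = i0 by move/fintype_le1P : card1 => /(_ i0) /(_ i).
  rewrite subr_le0; apply: (@le_trans _ _ (x t i0)).
    by apply: (vmax_le i0) => i; rewrite (all0 i).
  by apply: (vmin_ge i0) => i; rewrite (all0 i).
have [r0 [Nr0 tr0]] : exists r0, (N <= r0)%N /\ tstar <= tp r0.
  have /cvgryPge/(_ tstar)[r0 _ r0P] := tp_y.
  exists (maxn N r0); split; first exact: leq_maxl.
  by apply: r0P => /=; exact: leq_maxr.
pose b : R := 8 * m%:R * I.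
pose r q := (r0 + 2 * m * q)%N.
have rS q : r q.+1 = (r q + 2 * m)%N by rewrite /r mulnS addnCA addnC addnA.
have rSS q : r q.+2 = (r q + 4 * m)%N.
  by rewrite !rS -addnA -mulnDl.
have step q t : tp (r q.+1) <= t -> t <= tp (r q.+2) ->
    spread hbar x t <= theta * spread hbar x (tp (r q)) + b.
  rewrite rS rSS => t1 t2.
  rewrite (_ : b = 2 * ((4 * m)%:R * I)); last by rewrite natrM /b; ring.
  apply: (period_contraction sx) => //.
    by apply: le_trans tr0 _; apply: tp_mono; rewrite leq_addr.
  move=> p rp; apply: JI; apply: leq_trans rp; apply: leq_trans Nr0 _.
  by rewrite leq_addr.
pose B := b / (1 - theta).
have thB : theta * B + b = B by rewrite /B; field; rewrite subr_eq0 gt_eqF.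
have BI : B <= gain V theta * I.
  rewrite /B /gain [leRHS]mulrAC ler_wpM2r//.
    by rewrite invr_ge0 subr_ge0 ltW.
  rewrite /b ler_wpM2r// ler_wpM2l// ler_nat; exact: leq_pred.
pose E0 := `|spread hbar x (tp (r 0%N))|.
have decay q : spread hbar x (tp (r q)) <= theta ^+ q * E0 + B.
  elim: q => [|q IH].
    rewrite expr0 mul1r; apply: le_trans (ler_norm _) _; rewrite lerDl.
    apply: divr_ge0; last by rewrite subr_ge0 ltW.
    by rewrite /b !mulr_ge0 ?ler0n.
  have mono : tp (r q.+1) <= tp (r q.+2).
    by apply: tp_mono; rewrite [leqRHS]rS leq_addr.
  apply: le_trans (step q _ (lexx _) mono) _.
  by have := ler_wpM2l (ltW theta_gt0) IH; rewrite exprS; lra.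
have large n : forall q t, tp (r q.+1) <= t -> t <= tp (r (q.+1 + n)%N) ->
    spread hbar x t <= theta ^+ q.+1 * E0 + B.
  elim: n => [|n IH] q t t1 t2.
  - rewrite addn0 in t2; have {t1}t2 : t = tp (r q.+1) by apply/le_anti/andP.
    by rewrite t2; exact: decay.
  - have [tq|/ltW tq] := leP t (tp (r q.+2)).
      apply: le_trans (step q t t1 tq) _.
      by have := ler_wpM2l (ltW theta_gt0) (decay q); rewrite exprS; lra.
    rewrite addnS -addSn in t2; apply: le_trans (IH q.+1 t tq t2) _.
    rewrite lerD2r ler_wpM2r ?normr_ge0// exprS ger_pMl ?exprn_gt0//.
    exact: ltW.
have [q qP] : exists q, theta ^+ q.+1 * E0 <= e.
  have th1 : `|theta| < 1 by rewrite gtr0_norm.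
  have /cvgrPdist_le/(_ e e0)[q _ /(_ q.+1)] := cvg_geometric E0 th1.
  rewrite /= leqnSn sub0r normrN => /(_ isT) H; exists q.
  by rewrite mulrC; apply: le_trans (ler_norm _) H.
exists (tp (r q.+1)) => t /ltW qt.
have [n tn] : exists n, t <= tp (r (q.+1 + n)%N).
  have /cvgryPge/(_ t)[n _ nP] := tp_y.
  exists n; apply: nP => /=; rewrite /r.
  apply: leq_trans (leq_addl r0 _); apply: leq_trans (leq_addl q.+1 n) _.
  by rewrite leq_pmull// muln_gt0 m0.
have tst : tstar <= t.
  by apply: le_trans tr0 (le_trans _ qt); apply: tp_mono; rewrite leq_addr.
have [K _ xK] := solution_bounded t sx.
apply: (@le_trans _ _ (spread hbar x t)).
  apply: (vmax_vmin_le_spread i0 hbar_ge0 (K := K)) => s i hs st.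
  by apply: xK => //; rewrite (le_trans _ hs)// lerB.
have := large n q t qt tn; lra.
Qed.

End Disturbed.

(** * Limits superior and consensus *)

Section Limsup.
Context {R : realType}.

Lemma limn_esup_lt (u : (\bar R)^nat) (I : \bar R) : (limn_esup u < I)%E ->
  exists N, forall p, (N <= p)%N -> (u p < I)%E.
Proof.
move=> /ereal_inf_lt[_ [A [N _ NA] <-] supI]; exists N => p Np.
by apply: le_lt_trans supI; apply: ereal_sup_ubound; exists p => //; exact: NA.
Qed.

Lemma limf_esup_pinfty_le (g : R -> R) (X : R) :
  (forall e, 0 < e -> exists M, forall t, M < t -> g t <= X + e) ->
  (limf_esup (fun t => (g t)%:E) (pinfty_nbhs R) <= X%:E)%E.
Proof.
move=> gX; apply/lee_addgt0Pr => e e0; have [M MP] := gX e e0.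
apply: ereal_inf_le; exists (ereal_sup ((fun t => (g t)%:E) @` [set t | M < t])).
  exists [set t | M < t] => //; exists M; split => //; exact: num_real.
by apply: ge_ereal_sup => _ [t Mt <-]; rewrite -EFinD lee_fin MP.
Qed.

End Limsup.

Theorem lemma6 (R : realType) (V : finType) :
  exists C : R -> R,
  forall (hbar : R) (a h : V -> V -> R -> R) (tp : nat -> R) (theta : R),
    0 <= hbar ->
    (forall i j t, 0 <= t -> 0 <= a i j t) ->
    (forall i j, loc_summable (a i j)) ->
    (forall i j t, 0 <= t -> 0 <= h i j t /\ h i j t <= hbar) ->
    (forall i j, lebesgue_measurable `[0, +oo[ (h i j)) ->
    (hbar != 0 -> uniformly_bounded_integrals a) ->
    AQSC a tp ->
    0 < theta -> theta < 1 -> contraction_rate hbar a h tp theta ->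
    forall f : R -> V -> R, (forall i, loc_summable (f^~ i)) ->
    (forall (tstar : R) (x : R -> V -> R),
       0 <= tstar -> solution hbar a h f tstar x ->
       (limf_esup (fun t => (vmax (x t) - vmin (x t))%:E) (pinfty_nbhs R) <=
        (C theta)%:E *
        limn_esup (fun p => \int[leb]_(t in `[tp p, tp p.+1])
                              (norm_inf (f t))%:E))%E)
    /\
    ((forall i, \int[leb]_(t in `[tp p, tp p.+1]) `|f t i|
                  @[p --> \oo] --> (0 : R)) ->
     forall (tstar : R) (x : R -> V -> R),
       0 <= tstar -> solution hbar a h f tstar x ->
       vmax (x t) - vmin (x t) @[t --> +oo] --> (0 : R) /\
       ((exists i, cvg (x t i @[t --> +oo])) -> reaches_consensus x)).
Proof.
exists (gain V).
move=> hbar a h tp theta hbar0 a0 la h0 mh _ aqsc th0 th1 rate f lf.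
have [eps [_ [tp0 tpi tpy] qsc _]] := aqsc.
have [i0 _] := qsc 0%N.
have tpm : {homo tp : p q / (p <= q)%N >-> p <= q}.
  by move=> p q pq; rewrite tpi.
have h0' i j t : 0 <= t -> 0 <= h i j t by move=> t0; have [] := h0 i j t t0.
pose J p := \int[leb]_(t in `]tp p, tp p.+1]) norm_inf (f t).
have sJ p : summable_on (tp p) (tp p.+1) (fun t => norm_inf (f t)).
  by apply: summable_on_norm_inf => i; exact: loc_summable_on.
have ev tstar x N I := @disagreement_eventually R V i0 hbar a h tp theta hbar0 a0
  la h0' mh tp0 tpm tpy th0 th1 rate f lf tstar x N I.
have C0 : 0 < gain V theta by exact: gain_gt0.
have sub p : `[tp p, tp p.+1] `<=` `[0, tp p.+1].
  by apply: subset_itvr; rewrite bnd_simp.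
have cf p i : leb.-integrable `[tp p, tp p.+1] (EFin \o (f^~ i)).
  exact: (integrableS (leb_itv _) (leb_itv _) (sub p) (lf i _ (tp0 _))).
split.
- move=> tstar x ts0 sx.
  pose u p := (\int[leb]_(t in `[tp p, tp p.+1]) (norm_inf (f t))%:E)%E.
  set L := limn_esup (fun p => _); have LuE : L = limn_esup u by [].
  have Ju p : ((J p)%:E <= u p)%E.
    rewrite /J -(integral_fine (sJ p)).
    apply: ge0_subset_integral; try exact: leb_itv.
    + apply/measurable_EFinP; apply: measurable_norm_inf => i.
      by apply/measurable_EFinP; exact: measurable_int (cf p i).
    + by move=> s _; rewrite lee_fin norm_inf_ge0.
    + exact: subset_itv_oc_cc.
  have bound I : (L < I%:E)%E -> (limf_esup
      (fun t => (vmax (x t) - vmin (x t))%:E) (pinfty_nbhs R) <=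
      (gain V theta * I)%:E)%E.
    rewrite LuE => /limn_esup_lt[N NP]; apply: limf_esup_pinfty_le => e e0.
    apply: (ev tstar x N I sx _ e e0) => q Nq.
    by rewrite -lee_fin (le_trans (Ju q))// ltW// NP.
  case LE : L => [l| |].
  + apply/lee_addgt0Pr => e e0.
    have := bound (l + e / gain V theta).
    rewrite LE lte_fin ltrDl divr_gt0// => /(_ isT) /le_trans; apply.
    by rewrite -EFinM -EFinD lee_fin mulrDr [X in _ + X]mulrC divfK// gt_eqF.
  + by rewrite gt0_muley ?leey// lte_fin.
  + have /limn_esup_lt[N /(_ N (leqnn N))] : (limn_esup u < (-1)%:E)%E.
      by rewrite -LuE LE ltNyr.
    have J0 : 0 <= J N by apply: Rintegral_ge0 => s _; exact: norm_inf_ge0.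
    move=> /(le_lt_trans (Ju N)); rewrite lte_fin => /lt_trans/(_ (ltrN10 R)).
    by rewrite ltNge J0.
- move=> fi tstar x ts0 sx.
  have agree : vmax (x t) - vmin (x t) @[t --> +oo] --> (0 : R).
    apply/cvgrPdist_le => e e0.
    have n0 : 0 < #|V|%:R :> R.
      by rewrite ltr0n; apply/card_gt0P; exists i0.
    pose I := e / 2 / gain V theta; have I0 : 0 < I by do 2 apply: divr_gt0 => //.
    have In0 : 0 < I / #|V|%:R by rewrite divr_gt0.
    have : \forall p \near \oo, forall i,
        \int[leb]_(t in `[tp p, tp p.+1]) `|f t i| <= I / #|V|%:R.
      apply: filter_forall => i; have /cvgrPdist_le/(_ _ In0) := fi i.
      by apply: filterS => p; rewrite sub0r normrN; exact/le_trans/ler_norm.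
    move=> [N _ NP].
    have JI p : (N <= p)%N -> J p <= I.
      move=> Np; have sn i : summable_on (tp p) (tp p.+1) (fun t => `|f t i|).
        by apply: summable_on_norm; exact: loc_summable_on.
      apply: (@le_trans _ _ (\int[leb]_(t in `]tp p, tp p.+1]) \sum_i `|f t i|)).
        apply: le_Rintegral_itv => //; first by apply: summable_on_sum => i _.
        move=> s _ _; apply: norm_inf_le; first exact: sumr_ge0.
        by move=> i; rewrite (bigD1 i)//= lerDl sumr_ge0.
      rewrite Rintegral_itv_sum//.
      apply: (@le_trans _ _ (\sum_(i : V) (I / #|V|%:R))); last first.
        by rewrite sumr_const -[leLHS]mulr_natr divfK// gt_eqF.
      apply: ler_sum => i _; apply: le_trans (NP p Np i).
      by apply: Rintegral_itv_oc_le_cc => //; exact: integrable_norm.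
    have e2 : 0 < e / 2 by lra.
    have [M MP] := ev tstar x N I sx JI (e / 2) e2.
    exists M; split; first exact: num_real.
    move=> t Mt /=; rewrite sub0r normrN ger0_norm ?vmax_vmin_ge0//.
    apply: le_trans (MP t Mt) _; rewrite /I mulrC divfK ?gt_eqF//; lra.
  split=> // -[i /cvg_ex[l il]]; exists (fun=> l); split => // j.
  have diff : x t j - x t i @[t --> +oo] --> (0 : R).
    apply/cvgr0Pnorm_le => e e0; have /cvgr0Pnorm_le/(_ e e0) := agree.
    apply: filterS => t; apply: le_trans.
    rewrite [leRHS]ger0_norm ?vmax_vmin_ge0//; exact: dist_le_vmax_vmin.
  rewrite (_ : (fun t => x t j) = (fun t => (x t j - x t i) + x t i));
    last first.
    by apply/funext => t; rewrite subrK.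
  by rewrite -[X in _ --> X]add0r; exact: cvgD.
Qed.
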